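(* There are uncountably many Harary polynomials $\chi_{\mathcal{P}}$ (with $\mathcal{P}$ ranging over graph properties) which are d.p.-incomparable to the chromatic polynomial $\chi$.
   Context: All graphs are finite, simple, loop-free and have at least one vertex. A graph property $\mathcal{P}$ is a class of graphs closed under isomorphism. For a graph $G$ of order $n$, $h_i^{\mathcal{P}}(G)$ is the number of partitions of $V(G)$ into exactly $i$ nonempty blocks such that each block $B$ induces a graph $G[B]\in\mathcal{P}$. The Harary polynomial of $\mathcal{P}$ is the map $G\mapsto\chi_{\mathcal{P}}(G;k)=\sum_{i=1}^{n} h_i^{\mathcal{P}}(G)\,k_{(i)}\in\mathbb{Z}[k]$, where $k_{(i)}=k(k-1)\cdots(k-i+1)$. The chromatic polynomial $\chi$ is $\chi_{\mathcal{P}}$ for $\mathcal{P}$ the class of edgeless graphs. Two graph parameters $F_1,F_2$ are d.p.-incomparable if there are graphs $H_1,H_1',H_2,H_2'$ with $F_1(H_1)=F_1(H_1')$, $F_2(H_1)\neq F_2(H_1')$, $F_1(H_2)\neq F_1(H_2')$ and $F_2(H_2)=F_2(H_2')$. *)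

(* Defs.v *)
From mathcomp Require Import all_boot all_order all_algebra.
From mathcomp Require Import boolp.

Set Implicit Arguments.
Unset Strict Implicit.
Unset Printing Implicit Defensive.

Import GRing.Theory.
Local Open Scope ring_scope.

Record sgraph : Type := SGraph {
  vertex :> finType;
  adj : rel vertex;
  adj_sym : symmetric adj;
  adj_irrefl : irreflexive adj;
  vertex_gt0 : (0 < #|vertex|)%N
}.

Definition sg_iso (G H : sgraph) : Prop :=
  exists2 f : G -> H, bijective f & forall x y, adj (f x) (f y) = adj x y.

Definition graph_property (P : sgraph -> Prop) : Prop :=
  forall G H : sgraph, sg_iso G H -> P G -> P H.

Section Induced.
Variables (G : sgraph) (B : {set G}) (B_neq0 : B != set0).

Definition induced_adj : rel {x : G | x \in B} :=
  fun x y => adj (val x) (val y).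

Lemma induced_adj_sym : symmetric induced_adj.
Proof. by move=> x y; exact: adj_sym. Qed.

Lemma induced_adj_irrefl : irreflexive induced_adj.
Proof. by move=> x; exact: adj_irrefl. Qed.

Lemma induced_gt0 : (0 < #|{: {x : G | x \in B}}|)%N.
Proof. by rewrite card_sig card_gt0. Qed.

Definition induced : sgraph :=
  SGraph induced_adj_sym induced_adj_irrefl induced_gt0.

End Induced.

(* Blocks of a partition are nonempty, so quantifying over the proof that B is
   nonempty does not weaken the condition that G[B] satisfies P. *)
Definition harary_partition (P : sgraph -> Prop) (G : sgraph)
    (p : {set {set G}}) : Prop :=
  partition p [set: G] /\
  forall (B : {set G}) (B_neq0 : B != set0), B \in p -> P (induced B_neq0).

Definition harary_num (P : sgraph -> Prop) (G : sgraph) (i : nat) : nat :=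
  #|[set p : {set {set G}} | (#|p| == i) && `[< harary_partition P p >]]|.

Definition falling_poly (i : nat) : {poly int} :=
  \prod_(j < i) ('X - (j%:R)%:P).

Definition harary_poly (P : sgraph -> Prop) (G : sgraph) : {poly int} :=
  \sum_(1 <= i < #|G|.+1) falling_poly i *+ harary_num P G i.

Definition edgeless (G : sgraph) : Prop := forall x y : G, ~~ adj x y.

Definition chromatic_poly : sgraph -> {poly int} := harary_poly edgeless.

Definition is_harary_poly (F : sgraph -> {poly int}) : Prop :=
  exists2 P, graph_property P & F = harary_poly P.

Definition dp_incomparable (T1 T2 : Type)
    (F1 : sgraph -> T1) (F2 : sgraph -> T2) : Prop :=
  exists H1 H1' H2 H2' : sgraph,
    [/\ F1 H1 = F1 H1', F2 H1 <> F2 H1', F1 H2 <> F1 H2' & F2 H2 = F2 H2'].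

(* The unfolding given by countable_injP for cardinality.countable, which
   cannot be instantiated here: the type of graphs over arbitrary finTypes
   lies in a universe strictly above that of classical_sets.set. *)
Definition countably_many (T : Type) (A : T -> Prop) : Prop :=
  exists f : T -> nat, forall x y, A x -> A y -> f x = f y -> x = y.

(* Main.v *)
Require Import Defs.
From mathcomp Require Import all_boot all_order all_algebra.
From mathcomp Require Import boolp perm.

(** For a set [A] of naturals let [P_A] consist of the graphs of order 4 with a
    vertex adjacent to all others, and of all graphs of order [n + 5] with
    [n] in [A].  Evaluating a Harary polynomial at 1 tells whether the graph
    itself has the property, so the complete graph of order [n + 5] recovers
    whether [n] is in [A]; by Cantor's diagonal argument the polynomials of the
    [P_A] are uncountably many.  All of them vanish on graphs of order less
    than 4, while the chromatic polynomial separates the complete graphs of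
    orders 1 and 2; and all of them distinguish the star on 4 vertices from the
    path, which have the same chromatic polynomial because the path arises from
    the star by re-attaching a pendant vertex. *)

Set Implicit Arguments.
Unset Strict Implicit.
Unset Printing Implicit Defensive.

Import GRing.Theory.

(** * Evaluation of Harary polynomials at 1 *)

Lemma falling_poly_at1 (i : nat) :
  0 < i -> ((falling_poly i).[1] = (i == 1%N)%:R)%R.
Proof.
case: i => [//|[|i]] _; rewrite /falling_poly horner_prod.
  by rewrite big_ord1 !hornerE ?subr0.
(* For two or more factors, the one with [j = 1] vanishes at 1. *)
by rewrite !big_ord_recl !hornerE /= ?(subrr, mul0r, mulr0).
Qed.

Lemma harary_poly_at1 (P : sgraph -> Prop) (G : sgraph) :
  ((harary_poly P G).[1] = (harary_num P G 1%N)%:R)%R.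
Proof.
rewrite /harary_poly horner_sum big_ltn ?ltnS ?vertex_gt0 //.
rewrite hornerMn falling_poly_at1 // big_nat_cond big1 ?addr0 //.
move=> [|[|i]] /andP[/andP[// i_gt1 _] _].
by rewrite hornerMn falling_poly_at1 // mul0rn.
Qed.

Lemma induced_setT_iso (G : sgraph) (T_neq0 : [set: G] != set0) :
  sg_iso (induced T_neq0) G.
Proof.
exists val => //; exists (fun x : G => exist _ x (in_setT x)) => x //=.
exact: val_inj.
Qed.

Lemma sg_iso_sym (G H : sgraph) : sg_iso G H -> sg_iso H G.
Proof.
case=> f [g fK gK] f_adj; exists g; first by exists f.
by move=> x y; rewrite -f_adj !gK.
Qed.

(** The only one-block partition is [[set [set: G]]]. Its block induces a copy of [G] on a subtype,
    so closure under isomorphism is what carries [P] across. *)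
Lemma harary_num1 (P : sgraph -> Prop) (G : sgraph) :
  graph_property P -> harary_num P G 1 = `[< P G >].
Proof.
move=> P_iso; have T_neq0 : [set: G] != set0.
  by rewrite -card_gt0 cardsT vertex_gt0.
have G_iso := induced_setT_iso T_neq0.
have card1_part p : partition p [set: G] -> #|p| == 1 -> p = [set [set: G]].
  move=> /and3P[/eqP p_cover _ _] /cards1P[B pE].
  by rewrite pE -p_cover pE /cover big_set1.
have partT : partition [set [set: G]] [set: G].
  by rewrite /partition cover1 trivIset1 eqxx inE eq_sym T_neq0.
rewrite /harary_num; case: asboolP => PG /=.
  apply/eqP/cards1P; exists [set [set: G]]; apply/setP=> p; rewrite !inE.
  apply/andP/eqP => [[p1 /asboolP[p_part _]]|->]; first exact: card1_part.
  rewrite cards1; split=> //; apply/asboolP; split=> // B B_neq0 /set1P BE.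
  by subst B; exact: P_iso (sg_iso_sym (induced_setT_iso B_neq0)) PG.
apply/eqP; rewrite cards_eq0; apply/eqP/setP=> p; rewrite !inE.
apply/negbTE/negP => /andP[p1 /asboolP[p_part p_P]]; apply: PG.
apply: P_iso G_iso (p_P _ _ _).
by rewrite (card1_part _ p_part p1) set11.
Qed.

Lemma harary_poly_at1_property (P : sgraph -> Prop) (G : sgraph) :
  graph_property P -> ((harary_poly P G).[1] = `[< P G >]%:R)%R.
Proof. by move=> P_iso; rewrite harary_poly_at1 harary_num1. Qed.

Lemma sg_iso_card (G H : sgraph) : sg_iso G H -> #|G| = #|H|.
Proof. by case=> f /bij_eq_card. Qed.

Lemma edgeless_property : graph_property edgeless.
Proof.
move=> G H /sg_iso_sym[f _ f_adj] G0 x y.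
by rewrite -f_adj; exact: G0.
Qed.

(** * Partitions as colorings by blocks *)

Lemma partition_setT_pblock (T : finType) (p : {set {set T}}) (x : T) :
  partition p [set: T] -> (pblock p x \in p) * (x \in pblock p x).
Proof.
move=> /and3P[/eqP p_cover _ _].
by rewrite mem_pblock pblock_mem p_cover inE.
Qed.

(** With [pblock p x] as the color of [x], these partitions become proper colorings, in which single
    vertices can be recolored. *)
Lemma harary_edgelessP (G : sgraph) (p : {set {set G}}) :
  harary_partition edgeless p <->
  partition p [set: G] /\ forall x y, adj x y -> pblock p x <> pblock p y.
Proof.
split=> -[p_part p_ind]; split=> //.
  move=> x y xy p_xy; have [px xx] := partition_setT_pblock x p_part.
  have yx : y \in pblock p x by rewrite p_xy (partition_setT_pblock y p_part).
  have x_neq0 : pblock p x != set0 by apply/set0Pn; exists x.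
  by have /negP := p_ind _ x_neq0 px (exist _ x xx) (exist _ y yx).
move=> B B_neq0 pB x y; apply/negP => /p_ind; case/and3P: p_part => _ p_triv _.
by rewrite !(def_pblock p_triv pB (valP _)).
Qed.

(** A partition is the preimage partition of its own block map, which depends only on the kernel of
    that map. *)
Lemma partition_pblock_inj (T : finType) (p q : {set {set T}}) :
  partition p [set: T] -> partition q [set: T] ->
  (forall x y, (pblock p x == pblock p y) = (pblock q x == pblock q y)) ->
  p = q.
Proof.
move=> p_part q_part pq.
have preimE r : partition r [set: T] -> preim_partition (pblock r) [set: T] = r.
  exact: preim_partition_pblock.
rewrite -(preimE p) // -(preimE q) // /preim_partition /equivalence_partition.
by apply: eq_imset => x; apply/setP=> y; rewrite !inE /= pq.
Qed.

Lemma pblock_preim_eq (T : finType) (rT : eqType) (f : T -> rT) (x y : T) :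
  (pblock (preim_partition f [set: T]) x ==
   pblock (preim_partition f [set: T]) y) = (f x == f y).
Proof.
have f_part := preim_partitionP f [set: T].
have /and3P[/eqP f_cover f_triv _] := f_part.
rewrite eq_pblock // ?f_cover ?inE // pblock_equivalence_partition ?inE //.
by move=> a b c _ _ _; split=> // /eqP ->.
Qed.

Lemma card_preim_partition (T rT : finType) (f : T -> rT) :
  #|preim_partition f [set: T]| = #|[set f x | x : T]|.
Proof.
have -> : preim_partition f [set: T] =
    (fun c => [set y | c == f y]) @: [set f x | x : T].
  rewrite -imset_comp; apply/setP=> B.
  by apply/imsetP/imsetP=> -[x _ ->]; exists x => //; apply/setP=> y; rewrite !inE.
rewrite card_in_imset // => _ _ /imsetP[x _ ->] /imsetP[y _ ->] /setP/(_ x).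
by rewrite !inE eqxx => /esym/eqP.
Qed.

(** * Re-attaching a pendant vertex *)

Section MovePendant.

Variables (T : finType) (x v w : T).

(* If [x] is pendant at [v], only the block of [v] is forbidden to [x]; swapping
   the blocks of [v] and [w] makes that of [w] the forbidden one. *)
Definition move_color (p : {set {set T}}) (y : T) : {set T} :=
  if y == x then tperm (pblock p v) (pblock p w) (pblock p x) else pblock p y.

Definition move_partition (p : {set {set T}}) : {set {set T}} :=
  preim_partition (move_color p) [set: T].

Hypotheses (vNx : v != x) (wNx : w != x).

Lemma move_colorv p : move_color p v = pblock p v.
Proof. by rewrite /move_color (negPf vNx). Qed.

Lemma move_colorw p : move_color p w = pblock p w.
Proof. by rewrite /move_color (negPf wNx). Qed.

(** The move leaves the colors of [v] and [w] alone, and a transposition is an involution, so the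
    same swap restores the color of [x]. *)
Lemma move_colorK p y : pblock p y =
  if y == x
  then tperm (move_color p v) (move_color p w) (move_color p x)
  else move_color p y.
Proof.
rewrite move_colorv move_colorw /move_color eqxx.
by case: eqP => [->|//]; rewrite tpermK.
Qed.

(** The set of colors in use is unchanged: the swap can only exchange the blocks of [v] and [w], and
    both are still taken by [v] and [w] themselves. *)
Lemma card_move_partition p :
  partition p [set: T] -> #|move_partition p| = #|p|.
Proof.
move=> p_part; rewrite card_preim_partition.
rewrite -[in RHS](preim_partition_pblock p_part) card_preim_partition.
congr #|pred_of_set _|; apply/setP=> B.
apply/imsetP/imsetP=> -[y _ ->].
  rewrite /move_color; case: eqP => _; last by exists y.
  by case: tpermP => *; [exists w | exists v | exists x].
have [->|yNx] := eqVneq y x; last by exists y => //; rewrite /move_color (negPf yNx).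
have [xv|xNv] := eqVneq (pblock p x) (pblock p v).
  by exists v; rewrite ?move_colorv.
have [xw|xNw] := eqVneq (pblock p x) (pblock p w).
  by exists w; rewrite ?move_colorw.
by exists x; rewrite // /move_color eqxx tpermD // eq_sym.
Qed.

Lemma move_partition_inj :
  {in [pred p | partition p [set: T]] &, injective move_partition}.
Proof.
move=> p q p_part q_part pq; apply: partition_pblock_inj => //.
have ker y z : (move_color p y == move_color p z) = (move_color q y == move_color q z).
  by rewrite -(pblock_preim_eq (move_color p)) -/(move_partition p) pq pblock_preim_eq.
(* Equal moved partitions give equal kernels, not equal colors. This is enough to undo the swap,
   since it branches only on equalities between colors. *)
have kerx y : (tperm (move_color p v) (move_color p w) (move_color p x) == move_color p y)
    = (tperm (move_color q v) (move_color q w) (move_color q x) == move_color q y).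
  rewrite !permE /= !(ker x).
  by case: ifP => _; last case: ifP => _; rewrite ker.
move=> y z; rewrite !(move_colorK p, move_colorK q).
case: (y =P x) => _; case: (z =P x) => _; rewrite ?eqxx ?kerx ?ker //.
by rewrite eq_sym kerx eq_sym.
Qed.

Lemma move_pendant_le (e1 e2 : rel T) s1 s2 i1 i2 g1 g2 (k : nat) :
  (forall y z, y != x -> z != x -> e2 y z -> e1 y z) ->
  e1 x v -> (forall y, e2 x y -> y = w) ->
  harary_num edgeless (@SGraph T e1 s1 i1 g1) k <=
  harary_num edgeless (@SGraph T e2 s2 i2 g2) k.
Proof.
move=> e21 xv x_pend; rewrite /harary_num.
set S1 := [set p | _]; set S2 := [set p | _].
have S1_part p : p \in S1 -> partition p [set: T].
  by rewrite inE => /andP[_ /asboolP[]].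
rewrite -(card_in_imset (f := move_partition) (D := S1)); last first.
  by move=> p q /S1_part p_part /S1_part q_part; exact: move_partition_inj.
apply/subset_leq_card/subsetP => _ /imsetP[p pS ->].
have p_part := S1_part _ pS; move: pS; rewrite !inE => /andP[/eqP p_k].
move=> /asboolP/harary_edgelessP[_ /= p_ind].
rewrite card_move_partition // p_k eqxx; apply/asboolP/harary_edgelessP.
split=> [|y z /= yz]; first exact: preim_partitionP.
(* If [x] now shared the color of [w], undoing the swap would give it the old color of [v], against
   the edge [e1 x v]. *)
have pend u : e2 x u -> move_color p x <> move_color p u.
  move=> /x_pend ->; rewrite move_colorw /move_color eqxx.
  move/(congr1 (tperm (pblock p v) (pblock p w))).
  by rewrite tpermK tpermR; exact: p_ind.
apply/eqP; rewrite pblock_preim_eq; apply/eqP.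
have [yx|yNx] := eqVneq y x; first by rewrite yx in yz *; exact: pend.
have [zx|zNx] := eqVneq z x.
  by rewrite zx in yz *; move/esym; apply: pend; rewrite [e2 _ _]s2.
by rewrite /move_color (negPf yNx) (negPf zNx); apply: p_ind; exact: e21.
Qed.

End MovePendant.

(** * The star and the path on four vertices *)

(* A path 0 - 1 - 2 with the pendant vertex 3 attached to [v]. *)
Definition tree4_adj (v : nat) : rel 'I_4 := fun x y =>
  let e := [:: (0, 1); (1, 2); (v, 3)] in
  ((val x, val y) \in e) || ((val y, val x) \in e).

Lemma tree4_sym v : symmetric (tree4_adj v).
Proof. by move=> x y; rewrite /tree4_adj orbC. Qed.

Lemma tree4_irrefl v : v < 3 -> irreflexive (tree4_adj v).
Proof.
move=> v3 x; rewrite /tree4_adj orbb !inE !xpair_eqE.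
by case: x => -[|[|[|[|?]]]] ?; case: v v3 => [|[|[|?]]].
Qed.

Lemma ord4_gt0 : 0 < #|'I_4|. Proof. by rewrite card_ord. Qed.

Definition star4 : sgraph :=
  SGraph (tree4_sym 1) (tree4_irrefl (isT : 1 < 3)) ord4_gt0.

Definition path4 : sgraph :=
  SGraph (tree4_sym 2) (tree4_irrefl (isT : 2 < 3)) ord4_gt0.

Lemma chromatic_star4_path4 : chromatic_poly star4 = chromatic_poly path4.
Proof.
rewrite /chromatic_poly /harary_poly; apply: eq_bigr => i _; congr (_ *+ _)%R.
apply/eqP; rewrite eqn_leq /star4 /path4.
(* The bound is symmetric in [v] and [w], so using it in both directions gives equality. *)
have move1 (v w : 'I_4) s1 s2 i1 i2 g1 g2 : v < 3 -> w < 3 ->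
    harary_num edgeless (@SGraph 'I_4 (tree4_adj v) s1 i1 g1) i <=
    harary_num edgeless (@SGraph 'I_4 (tree4_adj w) s2 i2 g2) i.
  move=> v3 w3; apply: (@move_pendant_le _ (@Ordinal 4 3 isT) v w).
  - by rewrite -val_eqE neq_ltn v3.
  - by rewrite -val_eqE neq_ltn w3.
  - move=> y z; rewrite -!val_eqE /= /tree4_adj !inE !xpair_eqE.
    by move=> /negPf-> /negPf->; rewrite !andbF !orbF.
  - by rewrite /tree4_adj !inE eqxx !orbT.
  - move=> y; rewrite /tree4_adj !inE !xpair_eqE.
    case: w {s2 i2} w3 => -[|[|[|?]]] ? // _; case: y => -[|[|[|[|?]]]] ? // _;
      exact: val_inj.
apply/andP; split.
- exact: (move1 (@Ordinal 4 1 isT) (@Ordinal 4 2 isT)).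
- exact: (move1 (@Ordinal 4 2 isT) (@Ordinal 4 1 isT)).
Qed.

(** * Complete graphs and the properties encoding sets of naturals *)

Section Complete.

Variable n : nat.

Lemma complete_sym : symmetric (fun x y : 'I_n.+1 => x != y).
Proof. by move=> x y; rewrite eq_sym. Qed.

Lemma complete_irrefl : irreflexive (fun x y : 'I_n.+1 => x != y).
Proof. by move=> x; rewrite eqxx. Qed.

Lemma complete_gt0 : 0 < #|'I_n.+1|. Proof. by rewrite card_ord. Qed.

Definition complete : sgraph := SGraph complete_sym complete_irrefl complete_gt0.

End Complete.

Definition dominated (G : sgraph) : Prop :=
  exists v : G, forall u, u != v -> adj v u.

(** The shift by 5 keeps the orders that encode [A] above 4, so graphs of order at most 4 are
    treated alike for every [A]. *)
Definition order_property (A : nat -> Prop) (G : sgraph) : Prop :=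
  (#|G| = 4 /\ dominated G) \/ exists2 n, #|G| = n + 5 & A n.

Lemma order_property_iso (A : nat -> Prop) : graph_property (order_property A).
Proof.
move=> G H GH; have cGH := sg_iso_card GH.
case=> [[G4 [v v_dom]]|[n Gn An]]; last by right; exists n; rewrite -?cGH.
left; split; first by rewrite -cGH.
case: GH => f [g fK gK] f_adj; exists (f v) => u uNv.
by rewrite -(gK u) f_adj v_dom // -(inj_eq (can_inj fK)) gK.
Qed.

(** Every partition has a block, and blocks of order below 4 never have the property, so all
    coefficients vanish. *)
Lemma order_property_small (A : nat -> Prop) (G : sgraph) :
  #|G| < 4 -> harary_poly (order_property A) G = 0%R.
Proof.
move=> G_lt4; apply: big1 => i _; suff -> : harary_num (order_property A) G i = 0 by [].
apply/eqP; rewrite cards_eq0; apply/eqP/setP=> p; rewrite !inE.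
apply/negbTE/negP => /andP[_ /asboolP[p_part p_P]].
have /card_gt0P[x _] := vertex_gt0 G.
have [px xx] := partition_setT_pblock x p_part.
have x_neq0 : pblock p x != set0 by apply/set0Pn; exists x.
have lt4 : #|induced x_neq0| < 4.
  by rewrite card_sig; exact: leq_ltn_trans (max_card _) G_lt4.
case: (p_P _ x_neq0 px) => [[c4 _]|[n cn _]]; first by rewrite c4 in lt4.
by rewrite cn addnS ltnS addnC in lt4.
Qed.

Lemma order_property_star4 (A : nat -> Prop) : order_property A star4.
Proof.
left; split; first by rewrite card_ord.
exists (@Ordinal 4 1 isT) => u; rewrite -val_eqE /=.
by case: u => [[|[|[|[|]]]] ?].
Qed.

Lemma order_property_path4 (A : nat -> Prop) : ~ order_property A path4.
Proof.
case=> [[_ [v v_dom]]|[n]]; last by rewrite card_ord addnC.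
(* Every vertex of the path fails to dominate one of its ends 0 and 3. *)
have := v_dom (@Ordinal 4 0 isT); have := v_dom (@Ordinal 4 3 isT).
rewrite -!val_eqE /=; case: v {v_dom} => [[|[|[|[|]]]] ?] //=.
- by move=> /(_ isT).
- by move=> /(_ isT).
- by move=> _ /(_ isT).
- by move=> _ /(_ isT).
Qed.

(** The graph [complete m] has [m + 1] vertices, hence 4 here against 5 in [order_property]. *)
Lemma order_property_complete (A : nat -> Prop) (n : nat) :
  order_property A (complete (n + 4)) <-> A n.
Proof.
rewrite /order_property card_ord; split=> [[[]|[m]]|An].
- by rewrite addnC.
- by rewrite -addnS => /addIn->.
- by right; exists n; rewrite -?addnS.
Qed.

Lemma order_property_incomparable (A : nat -> Prop) :
  dp_incomparable (harary_poly (order_property A)) chromatic_poly.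
Proof.
(* The first two graphs have one and two vertices; their chromatic polynomials take the values 1 and
   0 at 1. *)
exists (complete 0), (complete 1), star4, path4; split.
- by rewrite !order_property_small // card_ord.
- move/(congr1 (fun q => q.[1]%R)).
  rewrite !harary_poly_at1_property; try exact: edgeless_property.
  rewrite asboolT; last by move=> x y; rewrite !ord1.
  by rewrite asboolF // => /(_ ord0 ord_max).
- move/(congr1 (fun q => q.[1]%R)).
  rewrite !harary_poly_at1_property; try exact: order_property_iso.
  by rewrite (asboolT (order_property_star4 A)) (asboolF (@order_property_path4 A)).
- exact: chromatic_star4_path4.
Qed.

Lemma order_property_inj (A B : nat -> Prop) :
  harary_poly (order_property A) = harary_poly (order_property B) ->
  forall n, A n <-> B n.
Proof.
move=> AB n; rewrite -(order_property_complete A) -(order_property_complete B).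
have /(congr1 (fun q => q.[1]%R)) := congr1 (@^~ (complete (n + 4))) AB.
rewrite !harary_poly_at1_property; try exact: order_property_iso.
by do 2!case: asboolP.
Qed.

Theorem theorem7p2 :
  ~ countably_many (fun F : sgraph -> {poly int} =>
      is_harary_poly F /\ dp_incomparable F chromatic_poly).
Proof.
case=> f f_inj; pose g A := f (harary_poly (order_property A)).
have g_inj A B : g A = g B -> forall n, A n <-> B n.
  move=> gAB; apply: order_property_inj; apply: f_inj gAB.
  - split; last exact: order_property_incomparable.
    by exists (order_property A); [exact: order_property_iso|].
  - split; last exact: order_property_incomparable.
    by exists (order_property B); [exact: order_property_iso|].
(* [D] holds the codes of sets omitting their own code. Injectivity of [g] up to extensional
   equality suffices: a set with code [g D] has the elements of [D]. *)
pose D n := exists2 A : nat -> Prop, g A = n & ~ A n.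
have DN : ~ D (g D).
  by case=> A gAD AN; apply: (AN); apply/(g_inj _ _ gAD); exists A.
by apply: (DN); exists D.
Qed.
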